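(* For $r,s\in\mathbb N$ and $m=\max(r,s)\geq1$, let $1\leq\lambda_1<\cdots<\lambda_s\leq r$ if $r\geq s$, or $1\leq\sigma_1<\cdots<\sigma_r\leq s$ and $\sigma_{r+1}=s+1$ if $r\leq s$. Let $(P_n(x))_{n\in\mathbb N}$ be the $m$-orthogonal polynomial sequence over $R=\mathbb Q(b_1,\dots,b_s)[a_1,\dots,a_r]$ defined by $$P_n(x)=\frac{(-1)^n(a_1)_n\cdots(a_r)_n}{\left(b_1^{(n-1)}\right)_n\cdots\left(b_s^{(n-1)}\right)_n}\;{}_{s+1}F_r\left(\left.\begin{matrix}-n,b_1^{(n-1)},\dots,b_s^{(n-1)}\\ a_1,\dots,a_r\end{matrix}\,\right|\,x\right),$$ and let $\mathrm H^{(m)}=(h_{n,k})_{n,k\in\mathbb N}$ be the production matrix of the generalised $m$-Stieltjes-Rogers polynomials $S^{(m)}_{n,k}(\alpha)$, where $\alpha=(\alpha_{k+m})_{k\in\mathbb N}$ is the sequence defined in the context, with $a_{r+1}=1$. Then, $(P_n(x))_{n\in\mathbb N}$ satisfies the $(m+1)$-order recurrence relation $$P_{n+1}(x)=x\,P_n(x)-\sum_{k=0}^{m}\gamma^{[k]}_{n-k}\,P_{n-k}(x)$$ (with terms of negative index $n-k<0$ omitted), where, setting $\alpha_j=0$ for $0\leq j\leq m-1$, $$\gamma^{[k]}_n=h_{n+k,n}=\sum_{m\geq\ell_0>\cdots>\ell_k\geq0}\ \prod_{j=0}^{k}\alpha_{(m+1)(n+j)+\ell_j}\qquad\text{for all }n\in\mathbb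 N\text{ and }0\leq k\leq m.$$
   Context: $\mathbb N=\{0,1,2,\dots\}$; $(z)_0=1$, $(z)_n=z(z+1)\cdots(z+n-1)$ for $n\ge1$; ${}_pF_q\left(\left.\begin{matrix}c_1,\dots,c_p\\ d_1,\dots,d_q\end{matrix}\,\right|\,x\right)=\sum_{n\ge0}\frac{(c_1)_n\cdots(c_p)_n}{(d_1)_n\cdots(d_q)_n}\frac{x^n}{n!}$. The $a_1,\dots,a_r,b_1,\dots,b_s$ are indeterminates. For integers $k$ and $n\geq1$, $[k]_n$ is the unique element of $\{1,\dots,n\}$ congruent to $k$ modulo $n$. Parameters, for integers $k\ge-1$, with $a_{r+1}=1$: if $r\geq s$, $a_i^{(k)}=a_i+\left\lceil\frac{k+1-i}{r+1}\right\rceil$ and $b_j^{(k)}=b_j+\left\lceil\frac{k+1-\lambda_j}{r}\right\rceil$; if $r\leq s$, $a_i^{(k)}=a_i+\left\lceil\frac{k+1-\sigma_i}{s+1}\right\rceil$ and $b_j^{(k)}=b_j+\left\lceil\frac{k+1-j}{s}\right\rceil$ (for $1\le i\le r+1$, $1\le j\le s$; the two agree when $r=s$). Coefficients, for $k\in\mathbb N$. If $r\ge s$: $\alpha_{k+r}=\dfrac{\prod_{i=1,i\neq[k]_{r+1}}^{r+1}a_i^{(k)}}{\prod_{j=1}^{s}b_j^{(k)}}$ if $[k]_r\notin\{\lambda_1,\dots,\lambda_s\}$, and $\alpha_{k+r}=\dfrac{\left(b_\ell^{(k)}-a_{[k]_{r+1}}^{(k)}\right)\prod_{i=1,i\neq[k]_{r+1}}^{r+1}a_i^{(k)}}{\left(b_\ell^{(k)}-1\right)\prod_{j=1}^{s}b_j^{(k)}}$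 if $[k]_r=\lambda_\ell$. If $r\le s$: $\alpha_{k+s}=-\dfrac{\prod_{i=1}^{r+1}a_i^{(k)}}{\left(b_{[k]_s}^{(k)}-1\right)\prod_{j=1}^{s}b_j^{(k)}}$ if $[k]_{s+1}\notin\{\sigma_1,\dots,\sigma_{r+1}\}$, and $\alpha_{k+s}=\dfrac{\left(b_{[k]_s}^{(k)}-a_\ell^{(k)}\right)\prod_{i=1,i\neq\ell}^{r+1}a_i^{(k)}}{\left(b_{[k]_s}^{(k)}-1\right)\prod_{j=1}^{s}b_j^{(k)}}$ if $[k]_{s+1}=\sigma_\ell$. Generalised $m$-Stieltjes-Rogers polynomials: a partial $m$-Dyck path is a finite path in $\mathbb N\times\mathbb N$ with steps $(1,1)$ (weight $1$) and $(1,-m)$ (weight $\alpha_i$ when starting from height $i$); $S^{(m)}_{n,k}(\alpha)$ is the sum of the weights (products of step weights) of the partial $m$-Dyck paths from $(0,0)$ to $((m+1)n,(m+1)k)$. The production matrix of the unit-lower-triangular matrix $(S^{(m)}_{n,k}(\alpha))$ is the unique row-finite matrix $\mathrm H$ with $S^{(m)}_{n,k}(\alpha)=(\mathrm H^n)_{0,k}$ for all $n,k\in\mathbb N$ (it is unit-lower-Hessenberg: zero above the superdiagonal, with superdiagonal entries equal to $1$). *)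

(* Defs.v *)
From HB Require Import structures.
From mathcomp Require Import all_boot all_order all_algebra.
From mathcomp Require Import mpoly.

Set Implicit Arguments.
Unset Strict Implicit.
Unset Printing Implicit Defensive.

Import Order.TTheory GRing.Theory Num.Theory.
Local Open Scope ring_scope.

(* All families a_i, b_j, lambda_j, sigma_i are indexed from 1, as functions on
   nat whose values outside the relevant range of indices are irrelevant. *)

Definition poch (A : comNzRingType) (z : A) (n : nat) : A :=
  \prod_(i < n) (z + i%:R).

(* The power series pFq(c; d | x), given by its sequence of coefficients, so
   that no truncation of the series is involved. *)
Definition pFq (K : fieldType) (c d : seq K) (n : nat) : K :=
  (\prod_(z <- c) poch z n) / (\prod_(z <- d) poch z n) / n`!%:R.

(* [k]_n, the representative of k modulo n in {1, ..., n} *)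
Definition bracket (k n : nat) : nat := if (n %| k)%N then n else (k %% n)%N.

Definition ceil_div (x : int) (n : nat) : int :=
  Num.ceil (x%:~R / n%:R : rat).

(** Row-finite matrices *)

(* A row-finite matrix is given by its rows, each of them a finitely supported
   sequence; {poly A} is the type of such sequences, so that the entry (i, j) of
   M is (M i)`_j. *)
Definition rfmatrix (A : comNzRingType) := nat -> {poly A}.

Definition rf_id (A : comNzRingType) : rfmatrix A := fun i => 'X^i.

Definition rf_mul (A : comNzRingType) (M N : rfmatrix A) : rfmatrix A :=
  fun i => \sum_(j < size (M i)) (M i)`_j *: N j.

Definition rf_exp (A : comNzRingType) (M : rfmatrix A) (n : nat) : rfmatrix A :=
  iter n (fun N => rf_mul N M) (@rf_id A).

Definition is_production_matrix (A : comNzRingType) (S : nat -> nat -> A)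
    (H : rfmatrix A) : Prop :=
  forall n k, S n k = (rf_exp H n 0%N)`_k.

(** Partial m-Dyck paths *)

(* A path is given by its sequence of steps: true is the rise (1, 1), false is
   the fall (1, -m). The abscissa is the number of steps, so only the height has
   to be tracked. *)

(* p is a path starting at height h, staying in N x N, and ending at height h' *)
Fixpoint dyck_path (m h : nat) (p : seq bool) (h' : nat) : bool :=
  match p with
  | [::] => h == h'
  | true :: p' => dyck_path m h.+1 p' h'
  | false :: p' => (m <= h)%N && dyck_path m (h - m)%N p' h'
  end.

Fixpoint path_weight (A : comNzRingType) (alpha : nat -> A) (m h : nat)
    (p : seq bool) : A :=
  match p with
  | [::] => 1
  | true :: p' => path_weight alpha m h.+1 p'
  | false :: p' => alpha h * path_weight alpha m (h - m)%N p'
  end.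

Definition stieltjes_rogers (A : comNzRingType) (m : nat) (alpha : nat -> A)
    (n k : nat) : A :=
  \sum_(p : (m.+1 * n).-tuple bool | dyck_path m 0 p (m.+1 * k))
     path_weight alpha m 0 p.

(* The sum over m >= l_0 > ... > l_k >= 0 of
   prod_(0 <= j <= k) alpha_((m + 1)(n + j) + l_j) *)
Definition decreasing_sum (A : comNzRingType) (m : nat) (alpha : nat -> A)
    (n k : nat) : A :=
  \sum_(l : {ffun 'I_k.+1 -> 'I_m.+1} |
        [forall i : 'I_k.+1, forall j : 'I_k.+1, (i < j)%N ==> (l j < l i)%N])
     \prod_(j < k.+1) alpha (m.+1 * (n + j) + l j)%N.

(** The ring of coefficients R = Q(b_1, ..., b_s)[a_1, ..., a_r] *)

Definition bfield (s : nat) : fieldType := {fraction {mpoly rat[s]}}.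
Definition coefR (r s : nat) : idomainType := {mpoly (bfield s)[r]}.

(* a_i for 1 <= i <= r, and a_(r+1) = 1 *)
Definition avar (r s i : nat) : coefR r s :=
  if @insub nat (fun o => (o < r)%N) 'I_r i.-1 is Some o then 'X_o else 1.

(* b_j for 1 <= j <= s *)
Definition bvar (r s j : nat) : coefR r s :=
  if @insub nat (fun o => (o < s)%N) 'I_s j.-1 is Some o
  then (FracField.tofrac ('X_o : {mpoly rat[s]}))%:MP else 0.

(** The parameters and the coefficients alpha *)

(* The two ways of giving the data: lambda_1 < ... < lambda_s when r >= s, or
   sigma_1 < ... < sigma_(r+1) = s+1 when r <= s; both are available when
   r = s. *)
Variant positions :=
  | Lambda of (nat -> nat)
  | Sigma of (nat -> nat).

Definition increasing_in (f : nat -> nat) (n N : nat) : Prop :=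
  (forall i, (0 < i <= n)%N -> (0 < f i <= N)%N) /\
  (forall i j, (0 < i)%N -> (i < j)%N -> (j <= n)%N -> (f i < f j)%N).

Definition admissible (r s : nat) (t : positions) : Prop :=
  match t with
  | Lambda lam => (s <= r)%N /\ increasing_in lam s r
  | Sigma sig => [/\ (r <= s)%N, increasing_in sig r s & sig r.+1 = s.+1]
  end.

Definition apar (r s : nat) (t : positions) (i : nat) (k : int) : coefR r s :=
  avar r s i +
  match t with
  | Lambda _ => (ceil_div (k + 1 - i%:Z) r.+1)%:~R
  | Sigma sig => (ceil_div (k + 1 - (sig i)%:Z) s.+1)%:~R
  end.

Definition bpar (r s : nat) (t : positions) (j : nat) (k : int) : coefR r s :=
  bvar r s j +
  match t with
  | Lambda lam => (ceil_div (k + 1 - (lam j)%:Z) r)%:~R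
  | Sigma _ => (ceil_div (k + 1 - j%:Z) s)%:~R
  end.

(* The index l in {1, ..., n} such that f l = x, if there is one *)
Definition position (f : nat -> nat) (n x : nat) : option nat :=
  omap val [pick l : 'I_n.+1 | (0 < l)%N && (f l == x)].

(* alpha_(k+m), where m = max(r, s). Divisions take place in R: the denominators
   are nonzero elements of Q(b_1, ..., b_s), hence units of R. *)
Definition alpha_shifted (r s : nat) (t : positions) (k : nat) : coefR r s :=
  let a i := apar r s t i k%:Z in
  let b j := bpar r s t j k%:Z in
  let prod_b := \prod_(1 <= j < s.+1) b j in
  match t with
  | Lambda lam =>
      let i0 := bracket k r.+1 in
      let prod_a := \prod_(1 <= i < r.+2 | i != i0) a i in
      if position lam s (bracket k r) is Some l
      then ((b l - a i0) * prod_a) / ((b l - 1) * prod_b)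
      else prod_a / prod_b
  | Sigma sig =>
      let j0 := bracket k s in
      if position sig r.+1 (bracket k s.+1) is Some l
      then ((b j0 - a l) * \prod_(1 <= i < r.+2 | i != l) a i)
             / ((b j0 - 1) * prod_b)
      else - ((\prod_(1 <= i < r.+2) a i) / ((b j0 - 1) * prod_b))
  end.

Definition alpha (r s : nat) (t : positions) (n : nat) : coefR r s :=
  let m := maxn r s in
  if (n < m)%N then 0 else alpha_shifted r s t (n - m).

(** The polynomials P_n *)

(* The a_i occur in the denominators of the hypergeometric series, so that the
   identity defining P_n is stated in the fraction field of R, coefficientwise
   as formal power series in x. *)
Definition hypergeometric_sequence (r s : nat) (t : positions)
    (P : nat -> {poly coefR r s}) : Prop :=
  let K : fieldType := {fraction (coefR r s)} in
  let a i : K := FracField.tofrac (avar r s i) in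
  forall n k : nat,
    let b j : K := FracField.tofrac (bpar r s t j (n%:Z - 1)) in
    (FracField.tofrac (P n)`_k : K) =
      (-1) ^+ n * (\prod_(1 <= i < r.+1) poch (a i) n)
        / (\prod_(1 <= j < s.+1) poch (b j) n)
      * pFq (- n%:R :: [seq b j | j <- iota 1 s]) [seq a i | i <- iota 1 r] k.

(** Existence of the objects specified above by a property *)

Lemma production_matrix_exists (A : comNzRingType) (S : nat -> nat -> A) :
  (forall n, S n n = 1) -> (forall n k, (n < k)%N -> S n k = 0) ->
  exists H : rfmatrix A, is_production_matrix S H.
Proof.
move=> S1 S0; pose row n : {poly A} := \poly_(k < n.+1) S n k.
pose rows := fix rows n : seq {poly A} := if n is n'.+1 then
  rcons (rows n') (row n'.+1 - \sum_(j < n') S n' j *: nth 0 (rows n') j) else [::].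
have szr n : size (rows n) = n by elim: n => //= n IH; rewrite size_rcons IH.
pose H : rfmatrix A := fun n => nth 0 (rows n.+1) n.
have nthr n j : (j < n)%N -> nth 0 (rows n) j = H j.
  elim: n => // n IH; rewrite ltnS leq_eqVlt => /orP[/eqP->//|jn].
  by rewrite /= nth_rcons szr jn IH.
have HE n : H n = row n.+1 - \sum_(j < n) S n j *: H j.
  rewrite {1}/H /= nth_rcons szr ltnn eqxx; congr (_ - _).
  by apply: eq_bigr => j _; rewrite nthr.
have szrow n : size (row n) = n.+1 by rewrite size_poly_eq // S1 oner_eq0.
have expE n : rf_exp H n 0%N = row n.
  elim: n => [|n IH].
    by rewrite /rf_exp /= /rf_id expr0 /row poly_def big_ord1 S1 scale1r.
  rewrite /rf_exp iterS -/(rf_exp H n) /rf_mul IH szrow big_ord_recr /=.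
  rewrite coef_poly ltnSn S1 scale1r [in X in _ + X]HE addrCA -[RHS]addr0; congr (_ + _).
  apply/eqP; rewrite subr_eq0; apply/eqP; apply: eq_bigr => j _.
  by rewrite coef_poly ltnS ltnW.
exists H => n k; rewrite expE coef_poly; case: ltnP => // ?; exact: S0.
Qed.

Lemma production_matrix_unique (A : comNzRingType) (S : nat -> nat -> A)
    (H H' : rfmatrix A) :
  (forall n, S n n = 1) -> (forall n k, (n < k)%N -> S n k = 0) ->
  is_production_matrix S H -> is_production_matrix S H' -> H =1 H'.
Proof.
move=> S1 S0 hH hH'.
have eE n : rf_exp H n 0%N = rf_exp H' n 0%N.
  by apply/polyP => k; rewrite -hH -hH'.
have sz n : size (rf_exp H n 0%N) = n.+1.
  apply/eqP; rewrite eqn_leq; apply/andP; split.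
    by apply/leq_sizeP => j nj; rewrite -hH S0.
  rewrite ltnNge; apply/negP => /leq_sizeP/(_ n (leqnn _))/eqP.
  by rewrite -hH S1 oner_eq0.
elim/ltn_ind => n IH.
have := eE n.+1; rewrite /rf_exp !iterS -/(rf_exp H n) -/(rf_exp H' n) /rf_mul -eE sz.
rewrite !big_ord_recr /= -hH S1 !scale1r.
rewrite (eq_bigr (fun j : 'I_n => (rf_exp H n 0)`_j *: H' j)); first exact: addrI.
by move=> j _; rewrite IH.
Qed.

Lemma dyck_path_height (m h : nat) (p : seq bool) (h' : nat) :
  dyck_path m h p h' -> (h' <= h + size p)%N.
Proof.
elim: p h => [|[] p IH] h /=; first by move/eqP->; rewrite addn0.
  by move/IH; rewrite addSnnS.
case/andP=> _ /IH /leq_trans; apply.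
by apply: leq_add; rewrite ?leq_subr.
Qed.

Lemma dyck_path_rise (m h : nat) (p : seq bool) : (0 < m)%N ->
  dyck_path m h p (h + size p) = (p == nseq (size p) true).
Proof.
move=> m0; elim: p h => [|[] p IH] h /=; first by rewrite addn0 eqxx.
  by rewrite -addSnnS IH.
apply/negbTE; apply/negP => /andP[_ /dyck_path_height].
by rewrite addnS -addSn leq_add2r leqNgt ltnS leq_subr.
Qed.

Lemma stieltjes_rogers_upper (A : comNzRingType) m (alpha : nat -> A) n k :
  (n < k)%N -> stieltjes_rogers m alpha n k = 0.
Proof.
move=> nk; apply: big1_seq => p /andP[/dyck_path_height].
by rewrite size_tuple add0n leq_pmul2l // leqNgt nk.
Qed.

Lemma stieltjes_rogers_diag (A : comNzRingType) m (alpha : nat -> A) n :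
  (0 < m)%N -> stieltjes_rogers m alpha n n = 1.
Proof.
move=> m0; rewrite /stieltjes_rogers (big_pred1 (nseq_tuple (m.+1 * n) true)); last first.
  move=> p; rewrite -[X in dyck_path _ _ _ X]add0n.
  by have := dyck_path_rise 0 p m0; rewrite size_tuple => ->.
rewrite /= ; move: (_ * _)%N => N; elim: N 0%N => //= N IH h; exact: IH.
Qed.

Lemma poch_add (A : comNzRingType) (z : A) k n :
  poch z (k + n) = poch z k * poch (z + k%:R) n.
Proof.
rewrite /poch big_split_ord /=; congr (_ * _); apply: eq_bigr => i _.
by rewrite natrD addrA.
Qed.

Lemma rmorph_poch (A B : comNzRingType) (f : {rmorphism A -> B}) (z : A) n :
  f (poch z n) = poch (f z) n.
Proof. by rewrite rmorph_prod; apply: eq_bigr => i _; rewrite rmorphD rmorph_nat. Qed.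

Lemma mpolyX_addr_neq0 (A : idomainType) n (o : 'I_n) (c : A) :
  'X_o + c%:MP != 0 :> {mpoly A[n]}.
Proof.
apply/eqP => /(congr1 (mcoeff U_(o))).
rewrite mcoeffD mcoeffX eqxx mcoeffC mcoeff0.
have -> : (U_(o) == 0 :> 'X_{1..n})%MM = false.
  by apply/negbTE; rewrite -mdeg_eq0 mdeg1.
by rewrite mulr0 addr0 => /eqP; rewrite oner_eq0.
Qed.

Lemma bvar_unit r s j (z : int) : (0 < j <= s)%N ->
  bvar r s j + z%:~R \is a GRing.unit.
Proof.
case/andP=> j0 js; rewrite /bvar; case: insubP => [o _ _|]; last by rewrite prednK ?js.
rewrite -(rmorph_int (@mpolyC r (bfield s))) -rmorphD; apply: rmorph_unit.
rewrite unitfE -(rmorph_int (@FracField.tofrac {mpoly rat[s]})) -rmorphD /=.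
by rewrite tofrac_eq0 -(rmorph_int (@mpolyC s rat)) mpolyX_addr_neq0.
Qed.

Lemma avar_neq0 r s i n : (0 < i <= r)%N -> avar r s i + n%:R != 0.
Proof.
case/andP=> i0 ir; rewrite /avar; case: insubP => [o _ _|]; last by rewrite prednK ?ir.
by rewrite -(rmorph_nat (@mpolyC r (bfield s))) mpolyX_addr_neq0.
Qed.

Lemma bpar_unit r s t j k (z : int) : (0 < j <= s)%N ->
  bpar r s t j k + z%:~R \is a GRing.unit.
Proof. by case: t => f js; rewrite /bpar -addrA -intrD bvar_unit. Qed.

Lemma poch_bpar_unit r s t j k n : (0 < j <= s)%N ->
  poch (bpar r s t j k) n \is a GRing.unit.
Proof.
by move=> js; rewrite /poch rpred_prod // => i _; rewrite -[_%:R]/(i%:Z%:~R) bpar_unit.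
Qed.

Lemma natr_coefR_unit r s n : (0 < n)%N -> (n%:R : coefR r s) \is a GRing.unit.
Proof.
move=> n0; rewrite -(rmorph_nat (@mpolyC r (bfield s))); apply: rmorph_unit.
rewrite unitfE -(rmorph_nat (@FracField.tofrac {mpoly rat[s]})) /= tofrac_eq0.
by rewrite -(rmorph_nat (@mpolyC s rat)) mpolyC_eq0 pnatr_eq0 -lt0n.
Qed.

Lemma hypergeometric_sequence_exists r s (t : positions) :
  exists P : nat -> {poly coefR r s}, hypergeometric_sequence t P.
Proof.
pose b n j : coefR r s := bpar r s t j (n%:Z - 1).
pose c n k : coefR r s := (-1) ^+ n * (\prod_(1 <= i < r.+1) poch (avar r s i + k%:R) (n - k))
  / (\prod_(1 <= j < s.+1) poch (b n j) n)
  * (poch (- n%:R) k * \prod_(1 <= j < s.+1) poch (b n j) k / k`!%:R).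
exists (fun n => \poly_(k < n.+1) c n k) => K a n k /=.
rewrite coef_poly ltnS /pFq big_cons !big_map.
have -> : iota 1 r = index_iota 1 r.+1 by rewrite /index_iota subn1.
have -> : iota 1 s = index_iota 1 s.+1 by rewrite /index_iota subn1.
have fr := @rmorphV _ _ (@FracField.tofrac (coefR r s)).
have poN : poch (- n%:R : K) k = FracField.tofrac (poch (- n%:R) k).
  by rewrite rmorph_poch rmorphN rmorph_nat.
case: leqP => [kn|nk]; last first.
  suff -> : poch (- n%:R : K) k = 0 by rewrite tofrac0 !mul0r mulr0.
  rewrite /poch (bigD1 (Ordinal nk)) //= addrC subrr mul0r //.
have pb m : \prod_(1 <= j < s.+1) poch (b n j) m \is a GRing.unit.
  rewrite big_seq rpred_prod // => j; rewrite mem_index_iota ltnS; exact: poch_bpar_unit.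
have pbE m : \prod_(1 <= j < s.+1) poch (FracField.tofrac (b n j) : K) m =
    FracField.tofrac (\prod_(1 <= j < s.+1) poch (b n j) m).
  by rewrite rmorph_prod; apply: eq_bigr => j _; rewrite rmorph_poch.
rewrite !pbE poN /c !rmorphM /= fr ?pb // fr ?natr_coefR_unit ?fact_gt0 //.
rewrite rmorph_nat rmorphXn rmorphN1 -!mulrA; congr (_ * _).
have -> : \prod_(1 <= i < r.+1) poch (a i) n = (\prod_(1 <= i < r.+1) poch (a i) k)
    * FracField.tofrac (\prod_(1 <= i < r.+1) poch (avar r s i + k%:R) (n - k)).
  rewrite rmorph_prod -big_split; apply: eq_bigr => i _ /=.
  by rewrite rmorph_poch rmorphD rmorph_nat -poch_add subnKC.
set X := \prod_(1 <= i < r.+1) poch (a i) k.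
have X0 : X != 0.
  rewrite /X prodf_seq_neq0; apply/allP => i; rewrite mem_index_iota ltnS => ir.
  rewrite /poch; apply/prodf_neq0 => q _.
  by rewrite -(rmorph_nat (@FracField.tofrac (coefR r s))) -rmorphD /= tofrac_eq0 avar_neq0.
move: X0; move: X => X X0.
have gen (A B C D E : K) :
    A * (B * (C * (D * E))) = X * A * (B * (C * (D * (X^-1 * E)))).
  by rewrite [X * A]mulrC -mulrA (mulrCA X B) (mulrCA X C) (mulrCA X D) mulVKf.
exact: gen.
Qed.

(* Main.v *)
(* Let w(h, d) be (-1)^d / d! times the product of the (a_i^(h) - d)_d over
   1 <= i <= r + 1, divided by the product of the (b_j^(h-1) - d)_d over
   1 <= j <= s. When h grows by 1, at most one a_i^(h) and at most one b_j^(h-1)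
   grow by 1, while each a_i^(h) grows by 1 over m + 1 steps and each b_j^(h) over
   m steps, so that a contiguous relation gives
   w(h + 1, d + 1) = w(h, d + 1) - alpha_h w(h - m, d).
   Equivalently V_h(y) = sum_d w(h, d) y^(h - (m+1) d) satisfies
   y V_h = V_(h+1) + alpha_h V_(h-m), which says that V is an eigenvector, for the
   eigenvalue y, of the transfer operator of partial m-Dyck paths. The (m+1)-st
   power of that operator, restricted to heights divisible by m + 1, is the
   production matrix H; as V_((m+1)n)(y) = P_n(y^(m+1)), this yields
   x P_n = sum_k h_(n,k) P_k. *)

Require Import Defs.
From HB Require Import structures.
From mathcomp Require Import all_boot all_order all_algebra.
From mathcomp Require Import mpoly.
From mathcomp Require Import ring zify.

Set Implicit Arguments.
Unset Strict Implicit.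
Unset Printing Implicit Defensive.

Import Order.TTheory GRing.Theory Num.Theory.
Local Open Scope ring_scope.

(** * Rows multiplied by row-finite matrices *)

Section LinearExtension.
Variables (A : comNzRingType).

(** The linear map sending ['X^j] to [N j]. It serves three purposes: a row times a matrix, the
    continuation of a path row by further steps ([N] a family of path rows), and the substitution of
    a sequence of polynomials V_j for the heights j. *)
Definition rf_act (N : rfmatrix A) (p : {poly A}) : {poly A} :=
  \sum_(j < size p) p`_j *: N j.

Lemma rf_act_widen n (p : {poly A}) (N : rfmatrix A) : (size p <= n)%N ->
  rf_act N p = \sum_(j < n) p`_j *: N j.
Proof.
move=> pn; rewrite /rf_act (big_ord_widen n (fun j => p`_j *: N j) pn) big_mkcond.
apply: eq_bigr => j _; case: ltnP => // pj.
by rewrite nth_default ?scale0r.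
Qed.

Lemma rf_act_is_linear (N : rfmatrix A) : linear (rf_act N).
Proof.
move=> c p q /=; pose n := maxn (size p) (size q).
have sp : (size p <= n)%N by rewrite leq_maxl.
have sq : (size q <= n)%N by rewrite leq_maxr.
rewrite (rf_act_widen _ sp) (rf_act_widen _ sq) (@rf_act_widen n); last first.
  by rewrite (leq_trans (size_polyD _ _)) // geq_max sq (leq_trans (size_scale_leq _ _)).
rewrite scaler_sumr -big_split; apply: eq_bigr => j _ /=.
by rewrite coefD coefZ scalerDl scalerA.
Qed.

HB.instance Definition _ (N : rfmatrix A) :=
  GRing.isLinear.Build A {poly A} {poly A} _ (rf_act N) (rf_act_is_linear N).

Lemma rf_actXn j (N : rfmatrix A) : rf_act N 'X^j = N j.
Proof.
rewrite /rf_act size_polyXn (bigD1 ord_max) //= coefXn eqxx scale1r big1 ?addr0 // => i.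
by move/negbTE; rewrite coefXn -val_eqE /= => ->; rewrite scale0r.
Qed.

Lemma rf_actD p q (N : rfmatrix A) : rf_act N (p + q) = rf_act N p + rf_act N q.
Proof. by rewrite linearD. Qed.

Lemma rf_actZ c p (N : rfmatrix A) : rf_act N (c *: p) = c *: rf_act N p.
Proof. by rewrite linearZ. Qed.

Lemma rf_act_sum n (c : 'I_n -> A) (e : 'I_n -> nat) (N : rfmatrix A) :
  rf_act N (\sum_(j < n) c j *: 'X^(e j)) = \sum_(j < n) c j *: N (e j).
Proof.
rewrite linear_sum; apply: eq_bigr => j _ /=.
by rewrite rf_actZ rf_actXn.
Qed.

End LinearExtension.

(** * The transfer operator of partial m-Dyck paths and its (m+1)-st power *)

Section Paths.
Variables (A : comNzRingType) (m : nat) (alpha : nat -> A).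
Hypothesis alpha_small : forall h, (h < m)%N -> alpha h = 0.

(** The distribution of end heights of weighted paths with N steps from h, as a generating
    polynomial. The forbidden falls, from h < m, are kept with the truncated end height h - m = 0;
    they contribute nothing because [alpha h] is then 0. *)
Fixpoint path_row (N h : nat) : {poly A} :=
  if N is N'.+1 then path_row N' h.+1 + alpha h *: path_row N' (h - m)
  else 'X^h.

Lemma path_rowP N h h' :
  \sum_(p : N.-tuple bool | dyck_path m h p h') path_weight alpha m h p
  = (path_row N h)`_h'.
Proof.
elim: N h => [|N IH] h.
  rewrite big_mkcond (big_pred1 [tuple]) => [/=|p]; last by apply/esym/eqP; exact: tuple0.
  by rewrite coefXn eq_sym; case: eqP.
rewrite /= coefD coefZ -!IH big_mkcond /=.
pose cons (x : bool * N.-tuple bool) := [tuple of x.1 :: x.2].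
pose uncons (p : N.+1.-tuple bool) := (thead p, [tuple of behead p]).
rewrite (reindex cons) /=; last first.
  exists uncons => [[b p] _|p _]; rewrite /cons /uncons /=.
    by congr pair; apply: val_inj.
  by rewrite -tuple_eta.
rewrite -(pair_bigA _ (fun b p => if dyck_path m h (cons (b, p)) h'
  then path_weight alpha m h (cons (b, p)) else 0)) /=.
rewrite big_bool /=; congr (_ + _); first by rewrite -big_mkcond.
rewrite mulr_sumr [RHS]big_mkcond /=; apply: eq_bigr => p _.
case: leqP => // /alpha_small ->.
by rewrite !mul0r if_same.
Qed.

Lemma path_row_add N M h : path_row (N + M) h = rf_act (path_row M) (path_row N h).
Proof.
elim: N h => [|N IH] h; first by rewrite rf_actXn.
by rewrite addSn /= !IH rf_actD rf_actZ.
Qed.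

(* The sum over i > l_0 > ... > l_(f-1) >= 0 of
   prod_(0 <= j < f) alpha_((m + 1)(n + j) + l_j) *)
Fixpoint decr_sum (i n f : nat) : A :=
  match i, f with
  | _, 0 => 1
  | 0, _.+1 => 0
  | i'.+1, f'.+1 => decr_sum i' n f + alpha (m.+1 * n + i') * decr_sum i' n.+1 f'
  end.

Lemma decr_sum0 i n : decr_sum i n 0 = 1.
Proof. by case: i. Qed.

Lemma decr_sumS i n f : decr_sum i.+1 n f.+1 =
  decr_sum i n f.+1 + alpha (m.+1 * n + i) * decr_sum i n.+1 f.
Proof. by []. Qed.

Lemma decr_sum_gt i n f : (i < f)%N -> decr_sum i n f = 0.
Proof.
elim: i n f => [|i IH] n [|f] // fi; rewrite decr_sumS !IH ?mulr0 ?addr0 //.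
exact: ltnW.
Qed.

(** In block 0 the first factor is alpha_(l_0) with l_0 < i <= m, which vanishes. *)
Lemma decr_sum_low i f : (i <= m)%N -> decr_sum i 0 f.+1 = 0.
Proof.
elim: i => // i IH im; rewrite decr_sumS IH ?(ltnW im) // muln0 add0n alpha_small //.
by rewrite mul0r addr0.
Qed.

(** Starting from a multiple of m + 1, the height modulo m + 1 counts the steps made, since a fall
    by m is congruent to a rise by 1. A fall at time l after g falls thus starts from (m+1)(n-g) +
    l. Read from the last fall to the first, times decrease and blocks increase from n + 1 - f to n,
    which is the index pattern of [decr_sum]. *)
Lemma path_row_block i n : (i <= m.+1)%N ->
  path_row i (m.+1 * n) =
  \sum_(f < n.+2) decr_sum i (n.+1 - f) f *: 'X^(m.+1 * (n.+1 - f) + i - m.+1).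
Proof.
elim: i => [|i IH] im.
  rewrite big_ord_recl big1 /= => [|f _]; last by rewrite scale0r.
  by rewrite addr0 scale1r subn0 addn0 mulnS addKn.
rewrite -addn1 path_row_add IH ?(ltnW im) // rf_act_sum /=.
pose e j f := (m.+1 * (n.+1 - f) + j - m.+1)%N.
rewrite (eq_bigr (fun f : 'I_n.+2 => decr_sum i (n.+1 - f) f *: 'X^((e i f).+1) +
   (decr_sum i (n.+1 - f) f * alpha (e i f)) *: 'X^(e i f - m))); last first.
  by move=> f _; rewrite scalerDr scalerA.
(* A rise after f + 1 falls is paired with a fall after f falls, both ending with f + 1 falls in
   total. The unpaired fall term, at f = n + 1, lies in block 0 and vanishes. *)
rewrite big_split /= big_ord_recl [X in _ + X]big_ord_recr /=.
rewrite subnn decr_sum_low // mul0r scale0r addr0 [RHS]big_ord_recl -addrA.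
congr (_ + _).
  by rewrite !decr_sum0 /e /= subn0; congr (_ *: 'X^_); lia.
rewrite -big_split /=; apply: eq_bigr => f _; rewrite /bump /= add1n addn1 subSS decr_sumS.
have fn := ltn_ord f.
rewrite scalerDl; congr (_ + _).
  (* Only in block 0 can the subtraction in the exponent be truncated, and there the coefficient is
     0. *)
  have [nf|nf] := ltnP f n; last first.
    by rewrite (_ : (n - f = 0)%N) ?decr_sum_low ?scale0r //; lia.
  by congr (_ *: 'X^_); rewrite /e; nia.
have -> : e i f = (m.+1 * (n - f) + i)%N by rewrite /e; nia.
rewrite mulrC (_ : n.+1 - f = (n - f).+1)%N; last by lia.
have [im'|] := ltnP (m.+1 * (n - f) + i) m; first by rewrite alpha_small // !mul0r !scale0r.
by move=> mi; congr (_ *: 'X^_); lia.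
Qed.

(** One period of m + 1 steps, with heights measured in units of m + 1: f falls lead from block n to
    block n + 1 - f. *)
Definition path_production : rfmatrix A :=
  fun n => \sum_(f < n.+2) decr_sum m.+1 (n.+1 - f) f *: 'X^(n.+1 - f).

Lemma path_row_period n :
  path_row m.+1 (m.+1 * n) = path_production n \Po 'X^(m.+1).
Proof.
rewrite path_row_block // /path_production linear_sum /=; apply: eq_bigr => f _.
by rewrite linearZ /= comp_Xn_poly -exprM addnK.

Qed.

(** A path of length (m+1)n from 0 is cut into n periods, each starting at a multiple of m + 1. *)
Lemma path_productionP : is_production_matrix (stieltjes_rogers m alpha) path_production.
Proof.
move=> n k; rewrite /stieltjes_rogers path_rowP.
suff -> : path_row (m.+1 * n) 0 = rf_exp path_production n 0%N \Po 'X^(m.+1).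
  by rewrite coef_comp_poly_Xn // dvdn_mulr // mulKn.
elim: n => [|n IH]; first by rewrite muln0 /= /rf_id comp_Xn_poly.
rewrite mulnSr path_row_add IH /rf_exp iterS -/(rf_exp _ n) /rf_mul.
move: (rf_exp _ n _) => p; rewrite linear_sum -/(path_row m.+1).
have -> : p \Po 'X^(m.+1) = \sum_(j < size p) p`_j *: 'X^(m.+1 * j).
  by rewrite comp_polyE; apply: eq_bigr => j _; rewrite exprM.
rewrite rf_act_sum; apply: eq_bigr => j _.
by rewrite path_row_period linearZ.
Qed.

(** Iterating the eigenvector relation expands ['X^N * V h] over all paths with N steps from h, each
    contributing its weight times V at its end height. *)
Lemma path_row_act N h (V : nat -> {poly A}) :
  (forall h, 'X * V h = V h.+1 + alpha h *: V (h - m)%N) ->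
  rf_act V (path_row N h) = 'X^N * V h.
Proof.
move=> hV; elim: N h => [|N IH] h; first by rewrite rf_actXn mul1r.
by rewrite /= rf_actD rf_actZ !IH exprSr -mulrA hV mulrDr scalerAr.
Qed.

Lemma coef_path_production n k :
  (path_production (n + k)%N)`_n = decr_sum m.+1 n k.+1.
Proof.
rewrite /path_production coef_sum.
(* Column n of row n + k is reached with exactly k + 1 falls. *)
have kn : (k.+1 < (n + k).+2)%N by lia.
rewrite (bigD1 (Ordinal kn)) //= coefZ coefXn big1 => [|f].
  by rewrite subSS addnK eqxx mulr1 addr0.
rewrite coefZ coefXn -val_eqE /= => fk; have := ltn_ord f.
case: eqP; rewrite ?mulr0 //; lia.
Qed.

Lemma production_shift n (V : nat -> {poly A}) :
  (forall h, 'X * V h = V h.+1 + alpha h *: V (h - m)%N) ->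
  'X^(m.+1) * V (m.+1 * n)%N =
  V (m.+1 * n.+1)%N +
  \sum_(k < n.+1) decr_sum m.+1 (n - k)%N k.+1 *: V (m.+1 * (n - k))%N.
Proof.
move=> hV; rewrite -path_row_act // path_row_block // rf_act_sum big_ord_recl.
rewrite decr_sum0 scale1r subn0 addnK; congr (_ + _); apply: eq_bigr => k _.
by rewrite lift0 subSS addnK.
Qed.


Lemma decr_sum_first i n f : decr_sum i n f.+1 =
  \sum_(l < i) alpha (m.+1 * n + l) * decr_sum l n.+1 f.
Proof.
elim: i => [|i IH]; first by rewrite big_ord0.
by rewrite big_ord_recr decr_sumS IH.
Qed.

Let decreasing_below i f (l : {ffun 'I_f -> 'I_m.+1}) :=
  [forall a : 'I_f, forall b : 'I_f, (a < b)%N ==> (l b < l a)%N]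
  && [forall a : 'I_f, (l a < i)%N].

(** Induction on the number of values: once l_0 = x is chosen, the others form a decreasing family
    bounded by x, with the block index moved up by one. *)
Lemma decr_sum_ffun i n f : (i <= m.+1)%N ->
  \sum_(l : {ffun 'I_f -> 'I_m.+1} | decreasing_below i l)
    \prod_(j < f) alpha (m.+1 * (n + j) + l j) = decr_sum i n f.
Proof.
elim: f i n => [|f IH] i n im.
  have u : all_equal_to ([ffun=> ord0] : {ffun 'I_0 -> 'I_m.+1}).
    by move=> l; apply/ffunP; case.
  rewrite decr_sum0 (big_pred1 [ffun=> ord0]) ?big_ord0 // => l.
  rewrite [l]u /= eqxx; apply/andP; split; by apply/forallP; case.
rewrite decr_sum_first (big_ord_widen _ (fun l => alpha (m.+1 * n + l) * decr_sum l n.+1 f) im).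
pose cons (p : 'I_m.+1 * {ffun 'I_f -> 'I_m.+1}) : {ffun 'I_f.+1 -> 'I_m.+1} :=
  [ffun j => oapp p.2 p.1 (unlift ord0 j)].
have cons0 p : cons p ord0 = p.1 by rewrite ffunE unlift_none.
have consS p j : cons p (lift ord0 j) = p.2 j by rewrite ffunE liftK.
rewrite (reindex cons) /=; last first.
  exists (fun l => (l ord0, [ffun j => l (lift ord0 j)])) => [[x l] _|l _].
    by rewrite cons0; congr pair; apply/ffunP => j; rewrite ffunE consS.
  apply/ffunP => j; case: (unliftP ord0 j) => [k|] ->; first by rewrite consS ffunE.
  by rewrite cons0.
have consP x l : decreasing_below i (cons (x, l)) = (x < i)%N && decreasing_below x l.
  apply/andP/and3P => [[/'forall_forallP D /forallP I]|[xi /'forall_forallP D /forallP I]].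
    split; first by have := I ord0; rewrite cons0.
      by apply/'forall_forallP => a b; have := D (lift ord0 a) (lift ord0 b); rewrite !consS.
    by apply/forallP => a; have := D ord0 (lift ord0 a); rewrite consS cons0.
  split.
    apply/'forall_forallP => a b; case: (unliftP ord0 a) => [a'|] ->;
      case: (unliftP ord0 b) => [b'|] ->; rewrite ?consS ?cons0 //=; first exact: D.
  apply/forallP => a; case: (unliftP ord0 a) => [a'|] ->; rewrite ?consS ?cons0 //.
  exact: ltn_trans (I _) xi.
transitivity (\sum_(x < m.+1 | (x < i)%N) \sum_(l | decreasing_below x l)
    \prod_(j < f.+1) alpha (m.+1 * (n + j) + cons (x, l) j)).
  by rewrite pair_big_dep; apply: eq_bigl => -[x l]; exact: consP.
apply: eq_bigr => x xi; rewrite -IH; last exact: ltnW.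
rewrite mulr_sumr; apply: eq_bigr => l _.
rewrite big_ord_recl cons0 addn0; congr (_ * _); apply: eq_bigr => j _.
by rewrite consS lift0 addSnnS.
Qed.

Lemma decreasing_sumE n k : decreasing_sum m alpha n k = decr_sum m.+1 n k.+1.
Proof.
rewrite -decr_sum_ffun //; apply: eq_bigl => l; rewrite /decreasing_below.
by rewrite [X in _ = _ && X](_ : _ = true) ?andbT //; apply/forallP => a.
Qed.

End Paths.

Arguments decr_sum {A} m alpha i n f : simpl never.

(** * Ceilings, residues and Pochhammer symbols *)

Lemma ceil_div_def x n c : (0 < n)%N -> (c - 1) * n%:Z < x <= c * n%:Z ->
  ceil_div x n = c.
Proof.
move=> n0 /andP[lo hi]; apply: ceil_def.
have nQ : (0 : rat) < n%:R by rewrite ltr0n.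
rewrite ltr_pdivlMr // ler_pdivrMr // -[n%:R]/(n%:Z%:~R) -!intrM.
by rewrite ltr_int ler_int lo.
Qed.

Lemma ceil_divP x n : (0 < n)%N ->
  (ceil_div x n - 1) * n%:Z < x <= ceil_div x n * n%:Z.
Proof.
move=> n0; have /andP[lo hi] := ceil_itv (x%:~R / n%:R : rat).
have nQ : (0 : rat) < n%:R by rewrite ltr0n.
move: lo hi; rewrite ltr_pdivlMr // ler_pdivrMr // -[n%:R]/(n%:Z%:~R) -!intrM.
by rewrite ltr_int ler_int => -> ->.
Qed.

Lemma ceil_divD x n : (0 < n)%N -> ceil_div (x + n%:Z) n = ceil_div x n + 1.
Proof.
move=> n0; apply: ceil_div_def => //; have := ceil_divP x n0.
by rewrite addrK !mulrDl mulN1r mul1r; lia.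
Qed.

(** The quotient x / n leaves an integer value exactly when n divides x; every jump of the
    parameters a_i^(k), b_j^(k) comes from this. *)
Lemma ceil_divS x n : (0 < n)%N ->
  ceil_div (x + 1) n = ceil_div x n + (n%:Z %| x)%Z%:R.
Proof.
move=> n0; apply: ceil_div_def => //; have := ceil_divP x n0.
case: (boolP (_ %| _)%Z) => [/dvdzP[q ->]|nx]; last first.
  suff : x <> ceil_div x n * n%:Z by lia.
  by move=> e; case/dvdzP: nx; exists (ceil_div x n).
move: (ceil_div _ _) => c h; have -> : q = c by nia.
by rewrite addrK mulrDl mul1r; lia.
Qed.

Lemma ceil_div_small x n : (- n%:Z < x <= 0) -> ceil_div x n = 0.
Proof. by move=> h; apply: ceil_div_def; lia. Qed.

Lemma bracketP n k i : (0 < i <= n)%N -> (n%:Z %| k%:Z - i%:Z)%Z = (i == bracket k n).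
Proof.
move=> /andP[i0 lein]; have n0 : (0 < n)%N by lia.
rewrite -eqz_mod_dvd !modz_nat eqz_nat /bracket /dvdn; case: (eqVneq (k %% n)%N 0%N) => [->|k0].
  rewrite eq_sym; move: lein; rewrite leq_eqVlt => /orP[/eqP->|ni]; first by rewrite modnn !eqxx.
  by rewrite modn_small // ; lia.
move: lein; rewrite leq_eqVlt => /orP[/eqP->|ni]; last by rewrite (modn_small ni) eq_sym.
by rewrite modnn (negbTE k0) gtn_eqF // ltn_pmod.
Qed.

Lemma pochSr (A : comNzRingType) (z : A) n : poch z n.+1 = poch z n * (z + n%:R).
Proof. by rewrite /poch big_ord_recr. Qed.

Lemma pochSl (A : comNzRingType) (z : A) n : poch z n.+1 = z * poch (z + 1) n.
Proof. by rewrite -add1n poch_add /poch big_ord1 addr0. Qed.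

Lemma poch1 (A : comNzRingType) n : poch (1 : A) n = n`!%:R.
Proof.
elim: n => [|n IH]; first by rewrite /poch big_ord0.
by rewrite pochSr IH factS mulnC natrM -nat1r.
Qed.

Lemma poch_opp_nat (A : comNzRingType) n q : (q <= n)%N ->
  poch (- n%:R : A) q * (n - q)`!%:R = (-1) ^+ q * n`!%:R.
Proof.
elim: q => [|q IH] qn; first by rewrite /poch big_ord0 subn0 expr0.
rewrite pochSr exprS mulN1r mulNr -IH 1?ltnW // -(subnSK qn) factS natrM subnSK //.
by rewrite natrB 1?ltnW //; ring.
Qed.

(** * The contiguous relation and the link with the hypergeometric series *)

Section ContiguousRelation.
Variables (K : fieldType) (r s : nat).

(* The coefficient of x^(N - d) in the polynomial P_N with parameters a and b,
   in terms of the shifted parameters a + N and b + N; the index r + 1, where a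
   is 1, accounts for the binomial coefficient. *)
Definition hyper_coef (a b : nat -> K) (d : nat) : K :=
  (-1) ^+ d / d`!%:R * (\prod_(1 <= i < r.+2) poch (a i - d%:R) d)
  / \prod_(1 <= j < s.+1) poch (b j - d%:R) d.

Lemma eq_hyper_coef (a a' b b' : nat -> K) d :
  (forall i, (0 < i <= r.+1)%N -> a i = a' i) ->
  (forall j, (0 < j <= s)%N -> b j = b' j) ->
  hyper_coef a b d = hyper_coef a' b' d.
Proof.
move=> ha hb; rewrite /hyper_coef; congr (_ * _ / _); apply: eq_big_nat => i.
  by rewrite ltnS => /ha ->.
by rewrite ltnS => /hb ->.
Qed.

Lemma hyper_coef0 (a b : nat -> K) : hyper_coef a b 0 = 1.
Proof.
rewrite /hyper_coef fact0 expr0 !big1 ?divr1 ?mulr1 // => i _; exact: big_ord0.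
Qed.

(** The Pochhammer symbol attached to a_(r+1) then starts with the factor 0. *)
Lemma hyper_coef_eq0 (a b : nat -> K) d :
  a r.+1 = d.+1%:R -> hyper_coef a b d.+1 = 0.
Proof.
move=> ad; rewrite /hyper_coef big_nat_recr //= ad subrr.
by rewrite pochSl mul0r !mulr0 mul0r.
Qed.

Hypothesis natK : forall n, n.+1%:R != 0 :> K.

Variables (x y : nat -> K) (ea eb : pred nat).
Hypothesis y_neq0 : forall j (z : int), (0 < j <= s)%N -> y j + z%:~R != 0.

(** To be read with x_i = a_i^(k) and y_j = b_j^(k), where [ea] and [eb] mark the parameters that
    jump. The Pochhammer products of the three terms share long common factors; cancelling them
    leaves only the linear factors of the hypothesis, the factor d + 1 there coming from (d+1)!
    against d!. *)
Lemma hyper_coef_contiguous (c : K) d :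
  d.+1%:R * c * ((\prod_(1 <= j < s.+1) y j) * \prod_(1 <= j < s.+1 | eb j) (y j - 1)) =
  (\prod_(1 <= i < r.+2) x i) * (\prod_(1 <= j < s.+1 | eb j) (y j - d.+1%:R))
  - (\prod_(1 <= i < r.+2) (x i - (ea i)%:R * d.+1%:R))
     * (\prod_(1 <= j < s.+1 | eb j) y j) ->
  hyper_coef (fun i => x i + 1) (fun j => y j + 1) d.+1 =
  hyper_coef (fun i => x i + 1 - (ea i)%:R) (fun j => y j + 1 - (eb j)%:R) d.+1
  - c * hyper_coef x (fun j => y j - (eb j)%:R) d.
Proof.
set Y := \prod_(1 <= j < s.+1) y j.
set G := \prod_(_ <= _ < _ | _) (y _ - 1).
set X := \prod_(1 <= i < r.+2) x i.
set Gd := \prod_(_ <= _ < _ | _) (y _ - d.+1%:R).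
set X' := \prod_(_ <= _ < _) (x _ - _).
set Gy := \prod_(_ <= _ < _ | _) y _.
move=> hc; rewrite /hyper_coef.
set U := \prod_(_ <= _ < _) poch (x _ - d%:R) d.
set V := \prod_(_ <= _ < _) poch (y _ - _ - d%:R) d.
set Dn := \prod_(_ <= _ < _) poch (y _ + 1 - d.+1%:R) d.+1.
set Do := \prod_(_ <= _ < _) poch (y _ + 1 - _ - d.+1%:R) d.+1.
have -> : \prod_(1 <= i < r.+2) poch (x i + 1 - d.+1%:R) d.+1 = U * X.
  rewrite -big_split; apply: eq_bigr => i _ /=.
  have -> : x i + 1 - d.+1%:R = x i - d%:R by rewrite -natr1; ring.
  by rewrite pochSr subrK.
have -> : \prod_(1 <= i < r.+2) poch (x i + 1 - (ea i)%:R - d.+1%:R) d.+1 = U * X'.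
  rewrite -big_split; apply: eq_bigr => i _ /=; case: (ea i) => /=.
    rewrite pochSl mul1r mulrC (addrK 1); congr (poch _ _ * _).
    by rewrite -natr1; ring.
  have -> : x i + 1 - 0%:R - d.+1%:R = x i - d%:R by rewrite -natr1; ring.
  by rewrite pochSr subrK mul0r subr0.
have yz z j : (0 < j < s.+1)%N -> y j - z%:R != 0.
  by rewrite ltnS => /(y_neq0 (- z%:Z)); rewrite rmorphN.
(* At a marked j, the extra factor prolongs the symbol in [Dn] downwards (by y_j - d - 1) or that in
   [Do] upwards (by y_j); both become the same product of d + 2 consecutive factors ending with (y_j
   - 1) y_j. *)
have hDn : Dn * Gd = V * Y * G.
  rewrite /Gd /G [X in _ * X]big_mkcond [X in _ = _ * X]big_mkcond -!big_split.
  apply: eq_big_nat => j /yz yj /=; case: (eb j) => /=; last first.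
    have -> : y j + 1 - d.+1%:R = y j - d%:R by rewrite -natr1; ring.
    by rewrite pochSr subrK !mulr1 subr0.
  have -> : y j + 1 - d.+1%:R = y j - d.+1%:R + 1 by ring.
  rewrite mulrC -pochSl !pochSr -natr1.
  have -> : y j - (d%:R + 1) = y j - 1%:R - d%:R by ring.
  by rewrite -natr1; ring.
have hDo : Do * Gy = V * Y * G.
  rewrite /Gy /G [X in _ * X]big_mkcond [X in _ = _ * X]big_mkcond -!big_split.
  apply: eq_big_nat => j /yz yj /=; case: (eb j) => /=; last first.
    have -> : y j + 1 - 0%:R - d.+1%:R = y j - d%:R by rewrite -natr1; ring.
    by rewrite pochSr subrK !mulr1 subr0.
  have -> : y j + 1 - 1%:R - d.+1%:R = y j - 1%:R - d%:R by rewrite -natr1; ring.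
  by rewrite pochSr; ring.
have prod_neq0 (P : pred nat) F : (forall j, (0 < j < s.+1)%N -> F j != 0) ->
    \prod_(1 <= j < s.+1 | P j) F j != 0 :> K.
  move=> hF; rewrite big_seq_cond prodf_seq_neq0; apply/allP => j.
  by rewrite mem_index_iota => hj; rewrite hF // implybT.
have Y0 : Y != 0 by apply: prod_neq0 => j /(yz 0%N); rewrite subr0.
have G0 : G != 0 by apply: prod_neq0 => j /(yz 1%N).
have Gd0 : Gd != 0 by apply: prod_neq0 => j /yz.
have Gy0 : Gy != 0 by apply: prod_neq0 => j /(yz 0%N); rewrite subr0.
have V0 : V != 0.
  apply: prod_neq0 => j hj; apply/prodf_neq0 => i _.
  have := y_neq0 (- (eb j)%:Z - d%:Z + i%:Z) hj.
  by rewrite !rmorphD !rmorphN /= !addrA.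
have d0 : d`!%:R != 0 :> K by rewrite -(prednK (fact_gt0 d)).
rewrite factS natrM exprS.
have := natK d; move: hc; rewrite [d.+1%:R]lock; move: (locked _) => d1 hc d10.
rewrite -[Dn](mulfK Gd0) hDn -[Do](mulfK Gy0) hDo.
have -> : c = (X * Gd - X' * Gy) / (d1 * (Y * G)).
  by rewrite -hc; field; rewrite d10 Y0 G0.
by field; rewrite d10 Y0 G0 Gd0 Gy0 V0 d0.
Qed.

End ContiguousRelation.

(** Split each (c)_n as (c)_q (c+q)_(n-q). The index r + 1 gives (1+q)_(n-q) = n!/q!, which with
    1/(n-q)! is, up to sign, the factor (-n)_q/q! of the series. *)
Lemma hyper_coef_pFq (K : fieldType) r s (a b : nat -> K) n q :
  (forall k, k.+1%:R != 0 :> K) -> a r.+1 = 1 ->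
  (forall i k, (0 < i <= r)%N -> a i + k%:R != 0) ->
  (forall j k, (0 < j <= s)%N -> b j + k%:R != 0) -> (q <= n)%N ->
  hyper_coef r s (fun i => a i + n%:R) (fun j => b j + n%:R) (n - q) =
  (-1) ^+ n * (\prod_(1 <= i < r.+1) poch (a i) n)
    / (\prod_(1 <= j < s.+1) poch (b j) n)
  * pFq (- n%:R :: [seq b j | j <- iota 1 s]) [seq a i | i <- iota 1 r] q.
Proof.
move=> natK a_last a_neq0 b_neq0 qn; rewrite /pFq (big_cons _ _ (- n%:R)) !big_map /hyper_coef.
set d := (n - q)%N; have dq : (q + d = n)%N by rewrite subnKC.
have shift c : c + n%:R - d%:R = c + q%:R :> K by rewrite -dq natrD; ring.
rewrite (eq_bigr _ (fun i _ => congr1 (fun z => poch z d) (shift (a i)))).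
rewrite (eq_bigr _ (fun j _ => congr1 (fun z => poch z d) (shift (b j)))).
rewrite [X in _ * X / _]big_nat_recr //= a_last.
have iotaE k : iota 1 k = index_iota 1 k.+1 by rewrite /index_iota subn1.
rewrite !iotaE.
have poch_split c k : \prod_(1 <= i < k.+1) poch (c i) n =
    (\prod_(1 <= i < k.+1) poch (c i) q) * \prod_(1 <= i < k.+1) poch (c i + q%:R) d :> K.
  by rewrite -big_split; apply: eq_bigr => i _ /=; rewrite -poch_add dq.
rewrite !poch_split.
have fact_neq0 k : k`!%:R != 0 :> K by rewrite -(prednK (fact_gt0 k)).
have prod_neq0 k p (c : nat -> K) e :
    (forall i j, (0 < i <= k)%N -> c i + j%:R != 0) ->
    \prod_(1 <= i < k.+1) poch (c i + p%:R) e != 0.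
  move=> hc; rewrite prodf_seq_neq0; apply/allP => i.
  rewrite mem_index_iota ltnS => hi; apply/prodf_neq0 => j _.
  by rewrite -addrA -natrD hc.
have prod0 k (c : nat -> K) :
    \prod_(1 <= i < k.+1) poch (c i + 0%:R) q = \prod_(1 <= i < k.+1) poch (c i) q.
  by apply: eq_bigr => i _; rewrite addr0.
have paq := prod_neq0 _ 0%N _ q a_neq0; have pbq := prod_neq0 _ 0%N _ q b_neq0.
have pbd := prod_neq0 _ q _ d b_neq0; rewrite !prod0 in paq pbq.
have top : poch (1 + q%:R) d = n`!%:R / q`!%:R :> K.
  by rewrite -[n`!%:R]poch1 -dq poch_add poch1 mulrAC mulfV // mul1r.
have bot : poch (- n%:R) q = (-1) ^+ q * n`!%:R / d`!%:R :> K.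
  by rewrite -poch_opp_nat // mulfK.
have sign : (-1) ^+ d = (-1) ^+ n * (-1) ^+ q :> K.
  by rewrite -dq exprD mulrAC -expr2 sqrr_sign mul1r.
rewrite top bot sign.
move: paq pbq pbd (fact_neq0 q) (fact_neq0 d); clear.
move: (\prod_(_ <= _ < _) _) (\prod_(_ <= _ < _) _) (\prod_(_ <= _ < _) _) (\prod_(_ <= _ < _) _).
move: ((-1) ^+ q) ((-1) ^+ n) (n`!%:R) (q`!%:R) (d`!%:R) => e e' N Q D A B C E.
move=> E0 C0 B0 Q0 D0; field.
by rewrite B0 C0 D0 E0 Q0.
Qed.

Lemma position_spec f n x :
  if position f n x is Some l then (0 < l <= n)%N /\ f l = x
  else forall l, (0 < l <= n)%N -> f l <> x.
Proof.
rewrite /position; case: pickP => [l /andP[l0 /eqP fl]|none] /=.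
  by rewrite l0 -ltnS ltn_ord.
move=> l /andP[l0 ln] fl; have ln' : (l < n.+1)%N by [].
by have := none (Ordinal ln'); rewrite /= l0 fl eqxx.
Qed.

Lemma increasing_in_inj f n N i j : increasing_in f n N ->
  (0 < i <= n)%N -> (0 < j <= n)%N -> (f i == f j) = (i == j).
Proof.
case=> _ lt_f /andP[i0 iN] /andP[j0 jN].
case: (ltngtP i j) => [ij|ji|->]; last exact: eqxx.
  by rewrite ltn_eqF // lt_f.
by rewrite gtn_eqF // lt_f.
Qed.

(** * Periods and jumps of the parameters *)

Section ParameterShifts.
Variables (r s : nat) (t : positions).
Let m := maxn r s.
Hypothesis m_gt0 : (0 < m)%N.
Hypothesis t_adm : admissible r s t.

(** [a_bump k] marks the a_i that grow from index k + m to k + m + 1, and [b_bump k] the b_j that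
    grow from k - 1 to k. *)
Definition a_bump (k i : nat) : bool :=
  match t with
  | Lambda _ => i == bracket k r.+1
  | Sigma sig => sig i == bracket k s.+1
  end.

Definition b_bump (k j : nat) : bool :=
  match t with
  | Lambda lam => lam j == bracket k r
  | Sigma _ => j == bracket k s
  end.

Lemma sigma_range sig i : t = Sigma sig -> (0 < i <= r.+1)%N -> (0 < sig i <= s.+1)%N.
Proof.
move=> e; move: t_adm; rewrite e => -[rs [sig_in _] sigr] /andP[i0].
rewrite leq_eqVlt => /orP[/eqP->|ir]; first by rewrite sigr leqnn.
by have := sig_in i; rewrite i0 -ltnS ir => /(_ isT) /andP[-> /leqW].
Qed.

Lemma apar_period i z : apar r s t i (z + m.+1%:Z) = apar r s t i z + 1.
Proof.
rewrite /apar -[RHS]addrA; congr (_ + _); rewrite -[X in _ = _ + X]/(1%:~R) /m.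
case: t t_adm => f [le_rs _]; rewrite -intrD.
  by rewrite (maxn_idPl le_rs) -ceil_divD //; congr (ceil_div _ _)%:~R; ring.
by move=> _; rewrite (maxn_idPr le_rs) -ceil_divD //; congr (ceil_div _ _)%:~R; ring.
Qed.

Lemma bpar_period j z : bpar r s t j (z + m%:Z) = bpar r s t j z + 1.
Proof.
rewrite /bpar -[RHS]addrA; congr (_ + _); rewrite -[X in _ = _ + X]/(1%:~R).
move: m_gt0; rewrite /m; case: t t_adm => f [le_rs _]; rewrite -intrD.
  by rewrite (maxn_idPl le_rs) => m0; rewrite -ceil_divD //; congr (ceil_div _ _)%:~R; ring.
by move=> _; rewrite (maxn_idPr le_rs) => m0; rewrite -ceil_divD //; congr (ceil_div _ _)%:~R; ring.
Qed.

(** The ceiling jumps when m + 1 divides k + m + 1 - c, that is when c is congruent to k modulo m +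
    1; here c is i or sigma_i. *)
Lemma aparS k i : (0 < i <= r.+1)%N ->
  apar r s t i (k + m).+1%:Z = apar r s t i (k + m)%:Z + (a_bump k i)%:R.
Proof.
move=> hi; rewrite /apar -[RHS]addrA; congr (_ + _); rewrite /a_bump (pmulrn 1 (nat_of_bool _)).
have ceilE (n c : nat) (hc : (0 < c <= n.+1)%N) : (n = m)%N ->
    ceil_div ((k + m).+1%:Z + 1 - c%:Z) n.+1 =
    ceil_div ((k + m)%:Z + 1 - c%:Z) n.+1 + (c == bracket k n.+1)%:Z.
  move=> nm; rewrite -bracketP // -nm.
  have -> : (k + n).+1%:Z + 1 - c%:Z = (k + n)%:Z + 1 - c%:Z + 1 by lia.
  rewrite ceil_divS //; congr (_ + _); rewrite natz; congr (Posz (nat_of_bool _)).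
  have -> : (k + n)%:Z + 1 - c%:Z = n.+1%:Z + (k%:Z - c%:Z) by lia.
  by rewrite rpredDl // dvdzz.
move: (@sigma_range); rewrite /m in ceilE *; case: t t_adm => f [le_rs _] => [sr|_ sr].
  by rewrite ceilE ?(maxn_idPl le_rs) // intrD.
by rewrite ceilE ?(maxn_idPr le_rs) ?(sr f) // intrD.
Qed.

Lemma bparS k j : (0 < j <= s)%N ->
  bpar r s t j k%:Z = bpar r s t j (k%:Z - 1) + (b_bump k j)%:R.
Proof.
move=> hj; rewrite /bpar -[RHS]addrA; congr (_ + _); rewrite /b_bump (pmulrn 1 (nat_of_bool _)).
have ceilE (n c : nat) (hc : (0 < c <= n)%N) :
    ceil_div (k%:Z + 1 - c%:Z) n =
    ceil_div (k%:Z - 1 + 1 - c%:Z) n + (c == bracket k n)%:Z.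
  have n0 : (0 < n)%N by lia.
  rewrite -bracketP //.
  have -> : k%:Z + 1 - c%:Z = k%:Z - c%:Z + 1 by ring.
  by rewrite ceil_divS // subrK natz.
case: t t_adm => f [_ [f_in _]] => [|_]; rewrite ceilE ?f_in ?intrD //.
Qed.

Lemma apar0 i : (0 < i <= r.+1)%N -> apar r s t i 0 = avar r s i.
Proof.
move=> hi; rewrite /apar -[RHS]addr0; congr (_ + _).
move: (@sigma_range); case: t => f sr; rewrite ceil_div_small //; first by lia.
by have := sr f i erefl hi; lia.
Qed.

Lemma apar_mul i n z :
  apar r s t i (z + (m.+1 * n)%:Z) = apar r s t i z + n%:R.
Proof.
elim: n => [|n IH]; first by rewrite muln0 !addr0.
by rewrite mulnSr PoszD addrA apar_period IH -natr1 addrA.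
Qed.

Lemma bpar_mul j n z :
  bpar r s t j (z + (m * n)%:Z) = bpar r s t j z + n%:R.
Proof.
elim: n => [|n IH]; first by rewrite muln0 !addr0.
by rewrite mulnSr PoszD addrA bpar_period IH -natr1 addrA.
Qed.

Lemma avar_last : avar r s r.+1 = 1.
Proof. by rewrite /avar; case: insubP => // o; rewrite ltnn. Qed.

(** The numerator in the ceiling is m + 1 - (m + 1) = 0. This value is what makes w((m+1)e + m, e +
    1) vanish. *)
Lemma apar_last : apar r s t r.+1 m%:Z = 1.
Proof.
rewrite /apar avar_last -[RHS]addr0; congr (_ + _); rewrite /m.
case: t t_adm => f [le_rs _] => [|f_last].
  by rewrite (maxn_idPl le_rs) ceil_div_small //; lia.
by rewrite (maxn_idPr le_rs) f_last ceil_div_small //; lia.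
Qed.

End ParameterShifts.

(** * The coefficients alpha solve the contiguous relation *)

Section ProductsWithOneException.
Variables (A : comNzRingType) (n q : nat) (P : pred nat).
Hypothesis q_range : (0 < q <= n)%N.

Lemma prod_pick (F : nat -> A) :
  (forall i, (0 < i <= n)%N -> P i = (i == q)) ->
  \prod_(1 <= i < n.+1 | P i) F i = F q.
Proof.
move=> Pq; rewrite big_mkcond (bigD1_seq q) ?iota_uniq ?mem_index_iota //=.
rewrite Pq // eqxx big_seq_cond big1 ?mulr1 // => i /andP[].
by rewrite mem_index_iota ltnS => /Pq -> /negbTE ->.
Qed.

Lemma prod_nat_split (F : nat -> A) :
  \prod_(1 <= i < n.+1) F i = F q * \prod_(1 <= i < n.+1 | i != q) F i.
Proof. by rewrite (bigD1_seq q) ?iota_uniq // mem_index_iota ltnS. Qed.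

Lemma prod_subr_pick (F : nat -> A) c :
  (forall i, (0 < i <= n)%N -> P i = (i == q)) ->
  \prod_(1 <= i < n.+1) (F i - (P i)%:R * c) =
  (F q - c) * \prod_(1 <= i < n.+1 | i != q) F i.
Proof.
move=> Pq; rewrite prod_nat_split Pq // eqxx mul1r; congr (_ * _).
rewrite big_nat_cond [RHS]big_nat_cond; apply: eq_bigr => i /andP[hi /negbTE iq].
by rewrite Pq // iq mul0r subr0.
Qed.

End ProductsWithOneException.

Lemma prod_pick0 (A : comNzRingType) n (P : pred nat) (F : nat -> A) :
  (forall i, (0 < i <= n)%N -> P i = false) ->
  \prod_(1 <= i < n.+1 | P i) F i = 1.
Proof.
move=> P0; rewrite big_nat_cond big_pred0 // => i; rewrite ltnS andbC.
by case hi: (_ <= _ <= _)%N; rewrite ?andbF // P0.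
Qed.

Lemma prod_subr_pick0 (A : comNzRingType) n (P : pred nat) (F : nat -> A) c :
  (forall i, (0 < i <= n)%N -> P i = false) ->
  \prod_(1 <= i < n.+1) (F i - (P i)%:R * c) = \prod_(1 <= i < n.+1) F i.
Proof.
by move=> P0; apply: eq_big_nat => i hi; rewrite P0 // mul0r subr0.
Qed.

Lemma bracket_range k n : (0 < n)%N -> (0 < bracket k n <= n)%N.
Proof.
move=> n0; rewrite /bracket; case: ifP => [_|/negbT]; first by rewrite n0 leqnn.
by rewrite /dvdn lt0n => ->; rewrite ltnW // ltn_pmod.
Qed.

(** At most one a and one b jump, so that only their linear factors matter: a(b-c) - (a-c)b = c(b-a)
    if both do, a - (a-c) = c if only an a does, and (b-c) - b = -c if only a b does. These are the
    cases in the definition of alpha. *)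
Lemma alpha_contiguous r s t k (c : coefR r s) :
  (0 < maxn r s)%N -> admissible r s t ->
  let a i := apar r s t i k%:Z in let b j := bpar r s t j k%:Z in
  c * alpha_shifted r s t k
    * ((\prod_(1 <= j < s.+1) b j) * \prod_(1 <= j < s.+1 | b_bump r s t k j) (b j - 1)) =
  (\prod_(1 <= i < r.+2) a i) * (\prod_(1 <= j < s.+1 | b_bump r s t k j) (b j - c))
  - (\prod_(1 <= i < r.+2) (a i - (a_bump r s t k i)%:R * c))
     * (\prod_(1 <= j < s.+1 | b_bump r s t k j) b j).
Proof.
move=> m0 t_adm a b.
have b_unit j : (0 < j <= s)%N -> b j \is a GRing.unit.
  by move=> /(bpar_unit r t k 0); rewrite addr0.
have b1_unit j : (0 < j <= s)%N -> b j - 1 \is a GRing.unit.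
  by move=> /(bpar_unit r t k (-1)).
have pb_unit : \prod_(1 <= j < s.+1) b j \is a GRing.unit.
  by rewrite big_seq rpred_prod // => j; rewrite mem_index_iota ltnS => /b_unit.
have cancel N D E : D \is a GRing.unit -> E = D -> c * (N / D) * E = c * N.
  by move=> uD ->; rewrite -mulrA divrK.
move: b_unit b1_unit pb_unit; rewrite /alpha_shifted /a_bump /b_bump {}/a {}/b.
case: t t_adm => f.
  move=> [sr f_in] b_unit b1_unit pb_unit.
  have rb := bracket_range k (ltn0Sn r).
  rewrite (prod_subr_pick rb) // (prod_nat_split rb (fun i => apar _ _ _ i _)).
  set a0 := apar _ _ _ (bracket _ _) _; set pa := \prod_(_ <= _ < _ | _) apar _ _ _ _ _.
  case: position (position_spec f s (bracket k r)) => [l [hl fl]|none].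
    have pickE F : \prod_(1 <= j < s.+1 | f j == bracket k r) F j = F l :> coefR r s.
      by apply: (prod_pick hl) => j hj; rewrite -fl (increasing_in_inj f_in).
    by rewrite !pickE cancel ?unitrM ?b1_unit // 1?mulrC //; ring.
  have pickE F : \prod_(1 <= j < s.+1 | f j == bracket k r) F j = 1 :> coefR r s.
    by apply: prod_pick0 => j /none /eqP/negbTE.
  by rewrite !pickE cancel ?mulr1 //; ring.
move=> [rs f_in f_last] b_unit b1_unit pb_unit.
have rb : (0 < bracket k s <= s)%N by apply: bracket_range; rewrite (maxn_idPr rs) in m0.
have pickE F : \prod_(1 <= j < s.+1 | j == bracket k s) F j = F (bracket k s) :> coefR r s.
  exact: (prod_pick rb).
rewrite !pickE.
case: position (position_spec f r.+1 (bracket k s.+1)) => [l [hl fl]|none].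
  rewrite (prod_subr_pick hl) => [|i hi]; last first.
    (* sigma remains strictly increasing up to index r + 1, because sigma_(r+1) = s + 1 exceeds the
       other values, which are at most s. *)
    rewrite -fl; have inj i' j' : (0 < i' <= r.+1)%N ->
        (0 < j' <= r.+1)%N -> (i' < j')%N -> (f i' < f j')%N.
      case: f_in => f_in f_lt /andP[i0 _] /andP[j0]; rewrite leq_eqVlt => /orP[/eqP->|jr] ij.
        by rewrite f_last ltnS; have := f_in i'; rewrite i0 -ltnS ij => /(_ isT)/andP[].
      exact: f_lt.
    case: (ltngtP i l) => [il|li|->]; last by rewrite eqxx.
      by rewrite ltn_eqF // inj.
    by rewrite gtn_eqF // inj.
  rewrite (prod_nat_split hl (fun i => apar _ _ _ i _)).
  by rewrite cancel ?unitrM ?b1_unit // 1?mulrC //; ring.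
rewrite prod_subr_pick0 => [|i /none /eqP/negbTE //].
by rewrite -mulNr cancel ?unitrM ?b1_unit // 1?mulrC //; ring.
Qed.

(** * The eigenvector V of the transfer operator *)

Section Recurrence.
Variables (r s : nat) (t : positions).
Let m := maxn r s.
Hypothesis m_gt0 : (0 < m)%N.
Hypothesis t_adm : admissible r s t.
Let K : fieldType := {fraction (coefR r s)}.
Let frac : coefR r s -> K := @FracField.tofrac (coefR r s).

Definition height_coef (h d : nat) : K :=
  hyper_coef r s (fun i => frac (apar r s t i h%:Z))
    (fun j => frac (bpar r s t j (h%:Z - 1))) d.

Lemma frac_nat_neq0 n : n.+1%:R != 0 :> K.
Proof.
rewrite -(rmorph_nat (@FracField.tofrac (coefR r s))) tofrac_eq0.
by apply: contraTneq (@natr_coefR_unit r s n.+1 isT) => ->; rewrite unitr0.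
Qed.

Lemma frac_bpar_neq0 j k z : (0 < j <= s)%N -> frac (bpar r s t j k) + z%:~R != 0.
Proof.
move=> hj; rewrite -(rmorph_int (@FracField.tofrac (coefR r s))) -rmorphD /= tofrac_eq0.
by apply: contraTneq (bpar_unit r t k z hj) => ->; rewrite unitr0.
Qed.

(** The contiguous relation around a^(k), b^(k): by periodicity, index k + m + 1 for a and k + m for
    b add 1 to every parameter, and the indices k + m, k + m - 1 and k - 1 differ from these by
    jumps only. *)
Lemma height_coefS k d :
  height_coef (k + m).+1 d.+1 =
  height_coef (k + m) d.+1 - frac (alpha r s t (k + m)) * height_coef k d.
Proof.
have -> : alpha r s t (k + m) = alpha_shifted r s t k.
  by rewrite /alpha -/m ltnNge leq_addl addnK.
pose x i := frac (apar r s t i k%:Z); pose y j := frac (bpar r s t j k%:Z).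
have H := @hyper_coef_contiguous K r s frac_nat_neq0 x y (a_bump r s t k)
  (b_bump r s t k) _ (frac (alpha_shifted r s t k)) d.
rewrite /height_coef.
have frac1 : frac 1 = 1 by exact: rmorph1.
have fracD a b : frac (a + b) = frac a + frac b by exact: rmorphD.
have fracB a b : frac (a - b) = frac a - frac b by exact: rmorphB.
have fracM a b : frac (a * b) = frac a * frac b by exact: rmorphM.
have frac_nat n : frac n%:R = n%:R by exact: rmorph_nat.
have aS i : apar r s t i (k + m).+1%:Z = apar r s t i k%:Z + 1.
  by rewrite -(apar_period t_adm) -addnS PoszD.
have bS j : bpar r s t j ((k + m).+1%:Z - 1) = bpar r s t j k%:Z + 1.
  by rewrite -(bpar_period m_gt0 t_adm); congr bpar; lia.
have b' j : (0 < j <= s)%N -> bpar r s t j (k%:Z - 1) = bpar r s t j k%:Z - (b_bump r s t k j)%:R.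
  by move=> hj; rewrite (bparS m_gt0 t_adm k hj) addrK.
rewrite (@eq_hyper_coef _ _ _ _ (fun i => x i + 1) _ (fun j => y j + 1)); last 2 first.
- by move=> i _; rewrite aS fracD frac1.
- by move=> j _; rewrite bS fracD frac1.
rewrite H => [|j z|]; last 2 first.
- exact: frac_bpar_neq0.
- have fracP (P : pred nat) n F :
    \prod_(1 <= j < n | P j) frac (F j) = frac (\prod_(1 <= j < n | P j) F j).
    by symmetry; exact: rmorph_prod.
  have yE c : \prod_(1 <= j < s.+1 | b_bump r s t k j) (y j - frac c) =
      frac (\prod_(1 <= j < s.+1 | b_bump r s t k j) (bpar r s t j k%:Z - c)).
    by rewrite -fracP; apply: eq_bigr => j _; rewrite fracB.
  have xE : \prod_(1 <= i < r.+2) (x i - (a_bump r s t k i)%:R * d.+1%:R) =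
      frac (\prod_(1 <= i < r.+2) (apar r s t i k%:Z - (a_bump r s t k i)%:R * d.+1%:R)).
    by rewrite -fracP; apply: eq_bigr => i _; rewrite fracB fracM !frac_nat.
  rewrite xE -[1]frac1 -frac_nat !yE /x /y !fracP -!fracM -fracB; congr frac.
  exact: alpha_contiguous.
congr (_ - _ * _); last first.
  by apply: eq_hyper_coef => // j hj; rewrite b' // fracB frac_nat.
apply: eq_hyper_coef => [i hi|j hj].
  rewrite /x -frac1 -frac_nat -fracD -fracB -aS.
  by rewrite (aparS m_gt0 t_adm) // addrK.
rewrite /y -frac1 -frac_nat -fracD -fracB.
have -> : (k + m)%:Z - 1 = k%:Z - 1 + m%:Z by lia.
by rewrite bpar_period // b' // addrAC.
Qed.

Lemma height_coef0 h : height_coef h 0 = 1.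
Proof. exact: hyper_coef0. Qed.

(** This is the would-be coefficient of y^(-1) in V_h for h = (m+1)e + m; its vanishing makes y V_h
    = V_(h+1) + alpha_h V_(h-m) hold at the constant term. *)
Lemma height_coef_eq0 e : height_coef (m.+1 * e + m) e.+1 = 0.
Proof.
apply: hyper_coef_eq0; rewrite addnC PoszD apar_mul // apar_last // nat1r.
exact: rmorph_nat.
Qed.

Definition height_poly (h : nat) : {poly K} :=
  \poly_(i < h.+1) if (m.+1 %| h - i)%N then height_coef h ((h - i) %/ m.+1) else 0.

Lemma height_polyS h :
  'X * height_poly h = height_poly h.+1 + frac (alpha r s t h) *: height_poly (h - m).
Proof.
have alpha_small : (h < m)%N -> frac (alpha r s t h) = 0.
  by move=> hm; rewrite /alpha hm; exact: rmorph0.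
apply/polyP => i; rewrite coefXM coefD coefZ !coef_poly !ltnS.
have [ih|hi] := leqP i h.+1; last first.
  have [-> ->] : (i == 0%N) = false /\ (i.-1 <= h)%N = false by lia.
  by rewrite ifF ?mulr0 ?addr0 //; lia.
have -> : (if i == 0%N then 0 else if (i.-1 <= h)%N then
    if (m.+1 %| h - i.-1)%N then height_coef h ((h - i.-1) %/ m.+1) else 0 else 0) =
    if (m.+1 %| h.+1 - i)%N then height_coef h ((h.+1 - i) %/ m.+1) else 0.
  case: i ih => [|i] ih /=; last by rewrite -ltnS ih subSS.
  rewrite subn0; case: ifP => // /dvdnP[[|e] he] //.
  rewrite he mulnK //; have -> : h = (m.+1 * e + m)%N by lia.
  by rewrite height_coef_eq0.
case: (boolP (_ %| _)%N) => [/dvdnP[e he]|ndvd]; last first.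
  case: (leqP m h) => [mh|/alpha_small ->]; last by rewrite mul0r addr0.
  case: ifP => [ihm|_]; last by rewrite mulr0 addr0.
  rewrite ifN ?mulr0 ?addr0 //; apply: contra ndvd.
  have -> : (h.+1 - i = m.+1 + (h - m - i))%N by lia.
  by rewrite dvdn_addr.
(* For e = 0 the leading coefficients 1 are compared, beyond the degree of V_(h-m); otherwise
   [height_coefS] applies. *)
rewrite he mulnK //; case: e he => [|e] he.
  by rewrite !height_coef0 ifF ?mulr0 ?addr0 //; lia.
have mh : (m <= h)%N by nia.
have -> : (i <= h - m)%N by nia.
have -> : (h - m - i = e * m.+1)%N by lia.
rewrite dvdn_mull // mulnK //; move: (height_coefS (h - m) e); rewrite subnK // => ->.
by rewrite subrK.
Qed.


(** At h = (m+1)n, n periods of the a_i give a_i + n; as h - 1 = (n-1) + mn, n periods of the b_j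
    give b_j^(n-1) + n. *)
Lemma height_poly_block (P : nat -> {poly coefR r s}) n : hypergeometric_sequence t P ->
  height_poly (m.+1 * n) = map_poly (@FracField.tofrac (coefR r s)) (P n) \Po 'X^(m.+1).
Proof.
move=> hP; apply/polyP => i; rewrite coef_poly coef_comp_poly_Xn // ltnS.
case: (boolP (m.+1 %| i)%N) => [/dvdnP[q ->{i}]|ndvd]; last first.
  case: leqP => // ilen; rewrite ifN //; apply: contra ndvd.
  by rewrite dvdn_subr // dvdn_mulr.
rewrite mulnK // coef_map /= hP (mulnC q) leq_pmul2l //.
have [qn|nq] := leqP q n; last first.
  rewrite /pFq big_cons (_ : poch (- n%:R) q = 0) ?mul0r ?mulr0 //.
  by rewrite /poch (bigD1 (Ordinal nq)) //= addrC subrr mul0r.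
rewrite -mulnBr dvdn_mulr // mulKn //.
have fracD a b : frac (a + b) = frac a + frac b by exact: rmorphD.
have frac_nat k : frac k%:R = k%:R by exact: rmorph_nat.
rewrite -hyper_coef_pFq //.
- apply: eq_hyper_coef => [i hi|j hj].
    by rewrite -[(m.+1 * n)%:Z]add0r apar_mul // apar0 // fracD frac_nat.
  have -> : (m.+1 * n)%:Z - 1 = n%:Z - 1 + (m * n)%:Z by rewrite mulSn PoszD; ring.
  by rewrite bpar_mul // fracD frac_nat.
- exact: frac_nat_neq0.
- by rewrite avar_last; exact: rmorph1.
- by move=> i k hi; rewrite -frac_nat -fracD tofrac_eq0 avar_neq0.
- move=> j k hj; exact: (frac_bpar_neq0 (n%:Z - 1) k%:Z hj).
Qed.

End Recurrence.

(** * Descent from the fraction field to R, and conclusion *)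

Lemma rmorph_decr_sum (A B : comNzRingType) (f : {rmorphism A -> B}) m al i n k :
  f (decr_sum m al i n k) = decr_sum m (fun h => f (al h)) i n k.
Proof.
elim: i n k => [|i IH] n [|k]; rewrite ?rmorph1 ?rmorph0 //.
by rewrite !decr_sumS rmorphD rmorphM !IH.
Qed.

Section BlockRecurrence.
Variables (A B : comNzRingType) (f : {rmorphism A -> B}) (m : nat) (al : nat -> A).
Hypothesis f_inj : injective f.

Lemma map_comp_Xn_inj : injective (fun p : {poly A} => map_poly f p \Po 'X^(m.+1)).
Proof.
move=> p q /polyP pq; apply/polyP => i; apply: f_inj; have := pq (i * m.+1)%N.
by rewrite !coef_comp_poly_Xn // dvdn_mull // mulnK // !coef_map.
Qed.

(** The period relation for V holds over B in the variable y; since p -> p(y^(m+1)) after an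
    injective change of coefficients is injective, it can be read back over A. *)
Lemma block_recurrence (P : nat -> {poly A}) (V : nat -> {poly B}) n :
  (forall h, (h < m)%N -> al h = 0) ->
  (forall h, 'X * V h = V h.+1 + f (al h) *: V (h - m)%N) ->
  (forall n, V (m.+1 * n)%N = map_poly f (P n) \Po 'X^(m.+1)) ->
  'X * P n = P n.+1 + \sum_(k < n.+1) decr_sum m al m.+1 (n - k) k.+1 *: P (n - k)%N.
Proof.
move=> al_small hV VP; apply: map_comp_Xn_inj.
have f_small h : (h < m)%N -> f (al h) = 0 by move=> /al_small ->; rewrite rmorph0.
rewrite rmorphM /= map_polyX rmorphM /= comp_polyX -VP (production_shift f_small n hV).
rewrite rmorphD rmorph_sum linearD linear_sum /= -VP; congr (_ + _); apply: eq_bigr => k _.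
by rewrite -rmorph_decr_sum map_polyZ linearZ /= -VP.
Qed.

End BlockRecurrence.

Theorem theorem6p6 (r s : nat) (t : positions)
    (P : nat -> {poly coefR r s}) (H : rfmatrix (coefR r s)) :
  let m := maxn r s in
  (1 <= m)%N ->
  admissible r s t ->
  hypergeometric_sequence t P ->
  is_production_matrix (stieltjes_rogers m (alpha r s t)) H ->
  let gamma (k n : nat) := (H (n + k)%N)`_n in
  (forall n : nat,
     P n.+1 = 'X * P n
              - \sum_(k < m.+1 | (k <= n)%N) gamma k (n - k)%N *: P (n - k)%N)
  /\
  (forall n k : nat, (k <= m)%N ->
     gamma k n = decreasing_sum m (alpha r s t) n k).
Proof.
move=> m m_gt0 t_adm hP hH gamma.
have alpha_small h : (h < m)%N -> alpha r s t h = 0 by rewrite /alpha -/m => ->.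
(* Uniqueness of the production matrix identifies [H] with the one built from paths. *)
have gammaE k n : gamma k n = decr_sum m (alpha r s t) m.+1 n k.+1.
  rewrite /gamma -coef_path_production -(production_matrix_unique _ _ hH) //.
  - by move=> n'; exact: stieltjes_rogers_diag.
  - exact: stieltjes_rogers_upper.
  - exact: path_productionP.
split=> [n|n k _]; last by rewrite gammaE decreasing_sumE.
have frac_inj : injective (@FracField.tofrac (coefR r s)).
  by move=> p q /eqP; rewrite tofrac_eq => /eqP.
have rec := block_recurrence frac_inj n alpha_small (height_polyS m_gt0 t_adm)
  (fun n => height_poly_block m_gt0 t_adm n hP).
rewrite rec -[LHS]addr0 -addrA; congr (_ + _); apply/esym/eqP; rewrite subr_eq0; apply/eqP.
under [RHS]eq_bigr do rewrite gammaE.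
(* Both sums are extended to a common range. The terms with m < k <= n vanish, as k + 1 distinct
   values do not fit in {0, ..., m}. *)
pose G k := decr_sum m (alpha r s t) m.+1 (n - k) k.+1 *: P (n - k)%N.
have nN : (n.+1 <= maxn m.+1 n.+1)%N by rewrite leq_maxr.
have mN : (m.+1 <= maxn m.+1 n.+1)%N by rewrite leq_maxl.
rewrite (big_ord_widen_cond _ xpredT G nN) (big_ord_widen_cond _ (fun k => (k <= n)%N) G mN).
rewrite [LHS]big_mkcond [RHS]big_mkcond; apply: eq_bigr => k _; rewrite !ltnS.
by case: leqP => //= _; case: leqP => // mk; rewrite /G decr_sum_gt ?scale0r.
Qed.
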